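(* Let $\Lambda$ be a left and right noetherian ring and let $m,n\in\mathbb{N}\cup\{\infty\}$. A finitely generated right $\Lambda$-module $M$ is $(m,n)$-torsionfree if and only if there exists an exact sequence $$ G_{m+1}\to G_m\to\cdots\to G_0\xrightarrow{\partial}G_{-1}\to\cdots\to G_{-n} $$ of $(m,n)$-torsionfree $\Lambda$-modules whose $\Lambda$-dual (the sequence obtained by applying $\operatorname{Hom}_\Lambda(-,\Lambda)$) is also exact, such that $M$ is isomorphic to the image of $\partial$.
   Context: $\mathbb{N}$ denotes the nonnegative integers. Modules are finitely generated right $\Lambda$-modules unless said otherwise; left modules are viewed as right $\Lambda^{\mathrm{op}}$-modules. Put $(-)^\ast=\operatorname{Hom}_\Lambda(-,\Lambda)$. Transpose: if $P_1\xrightarrow{f}P_0\to M\to0$ is exact with $P_0,P_1$ finitely generated projective, the (Auslander) transpose of $M$ is $\operatorname{Tr}M=\operatorname{Coker}(f^\ast:P_0^\ast\to P_1^\ast)$, a finitely generated $\Lambda^{\mathrm{op}}$-module, well defined up to projective direct summands. For $m,n\in\mathbb{N}\cup\{\infty\}$, a finitely generated $\Lambda$-module $M$ is $(m,n)$-torsionfree if $\operatorname{Ext}_\Lambda^i(M,\Lambda)=0$ for all $1\le i\le m$ and $\operatorname{Ext}_{\Lambda^{\mathrm{op}}}^j(\operatorname{Tr}M,\Lambda)=0$ for all $1\le j\le n$; when $m=\infty$ (resp. $n=\infty$) this means vanishing for all $i\ge1$ (resp. all $j\ge1$). Conventions on the sequence: exactness means exactness at every term which is not an end term. If $m=\infty$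 the sequence is infinite to the left; if $n=\infty$ it is infinite to the right. If $n=0$, the sequence is $G_{m+1}\to\cdots\to G_1\to G_0$ and $\partial$ is read as the canonical surjection from $G_0$ onto $\operatorname{Coker}(G_1\to G_0)$, so that the condition says $M\cong\operatorname{Coker}(G_1\to G_0)$. *)

(* Defs.v *)
From HB Require Import structures.
From mathcomp Require Import all_boot all_order all_algebra.
From mathcomp Require Import boolp classical_sets.

Set Implicit Arguments.
Unset Strict Implicit.
Unset Printing Implicit Defensive.

Import Order.TTheory GRing.Theory Num.Theory.
Local Open Scope classical_set_scope.
Local Open Scope ring_scope.

(* [lmodType R] is the type of left R-modules, so the type of right
   Lambda-modules is [lmodType Lambda^c].  Everything below is stated for left
   modules over an arbitrary ring R and is meant to be read at R := Lambda^c.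
   With this reading a Lambda^op-module is an [lmodType R^c]. *)

Definition left_ideal (R : pzRingType) (I : set R) : Prop :=
  I 0 /\ forall a x y, I x -> I y -> I (a * x + y).

(* [left_noetherian R^c] says that R is right noetherian. *)
Definition left_noetherian (R : pzRingType) : Prop :=
  forall I : nat -> set R,
    (forall k, left_ideal (I k)) -> (forall k, I k `<=` I k.+1) ->
  exists N, forall k, (N <= k)%N -> I k = I N.

Definition fin_gen (R : pzRingType) (M : lmodType R) : Prop :=
  exists n (e : 'I_n -> M), forall x, exists c : 'I_n -> R,
    x = \sum_(i < n) c i *: e i.

Definition surjective (A B : Type) (f : A -> B) : Prop := range f = setT.

(* The middle term B is the one at which exactness is asserted. *)
Definition exact_at (A B : Type) (C : nmodType) (f : A -> B) (g : B -> C) : Prop :=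
  range f = [set y | g y = 0].

Definition projective (R : pzRingType) (P : lmodType R) : Prop :=
  forall (A B : lmodType R) (g : {linear A -> B}) (f : {linear P -> B}),
    surjective g -> exists h : {linear P -> A}, g \o h =1 f.

Definition dual (R : pzRingType) (M : lmodType R) : Type := {linear M -> R^o}.

HB.instance Definition _ (R : pzRingType) (M : lmodType R) :=
  Choice.copy (dual M) {classic dual M}.

Lemma dualP (R : pzRingType) (M : lmodType R) (phi psi : dual M) :
  phi =1 psi -> phi = psi.
Proof.
case: phi psi => [f [[fN] [fZ]]] [g [[gN] [gZ]]] /funext /= fg; subst g.
by rewrite (Prop_irrelevance fN gN) (Prop_irrelevance fZ gZ).
Qed.

Section DualModule.
Variables (R : pzRingType) (M : lmodType R).
Implicit Types (phi psi : dual M) (a b : R^c).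

Definition dual_add phi psi : dual M := (phi : {linear M -> R^o}) \+ psi.
Definition dual_opp phi : dual M := \- (phi : {linear M -> R^o}).
Definition dual_zero : dual M := (\0 : M -> R^o).

Definition dual_scale_fun a phi (x : M) : R^o := (phi x : R) * (a : R).

Fact dual_scale_linear a phi : linear (dual_scale_fun a phi).
Proof.
move=> r x y; rewrite /dual_scale_fun linearP mulrDl.
by congr (_ + _); rewrite -[r *: _]/(r * _) -mulrA.
Qed.
HB.instance Definition _ a phi :=
  GRing.isLinear.Build R M R^o *:%R (dual_scale_fun a phi)
    (dual_scale_linear a phi).
Definition dual_scale a phi : dual M := dual_scale_fun a phi.

Fact dual_addA : associative dual_add.
Proof. by move=> f g h; apply/dualP => x; exact: addrA. Qed.
Fact dual_addC : commutative dual_add.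
Proof. by move=> f g; apply/dualP => x; exact: addrC. Qed.
Fact dual_add0 : left_id dual_zero dual_add.
Proof. by move=> f; apply/dualP => x; exact: add0r. Qed.
Fact dual_addN : left_inverse dual_zero dual_opp dual_add.
Proof. by move=> f; apply/dualP => x; exact: addNr. Qed.
HB.instance Definition _ :=
  GRing.isZmodule.Build (dual M) dual_addA dual_addC dual_add0 dual_addN.

Fact dual_scaleA a b phi :
  dual_scale a (dual_scale b phi) = dual_scale (a * b) phi.
Proof. by apply/dualP => x; rewrite /= /dual_scale_fun /= -mulrA. Qed.
Fact dual_scale1 : left_id 1 dual_scale.
Proof. by move=> phi; apply/dualP => x; exact: mulr1. Qed.
Fact dual_scaleDr : right_distributive dual_scale +%R.
Proof. by move=> a f g; apply/dualP => x; exact: mulrDl. Qed.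
Fact dual_scaleDl phi : {morph dual_scale^~ phi : a b / a + b}.
Proof. by move=> a b; apply/dualP => x; exact: mulrDr. Qed.
HB.instance Definition _ :=
  GRing.Zmodule_isLmodule.Build R^c (dual M)
    dual_scaleA dual_scale1 dual_scaleDr dual_scaleDl.

End DualModule.

Section DualMap.
Variables (R : pzRingType) (M N : lmodType R) (f : {linear M -> N}).

Definition dual_map (phi : dual N) : dual M :=
  (phi : {linear N -> R^o}) \o f.

Fact dual_map_linear : linear (dual_map : dual N -> dual M).
Proof. by move=> a phi psi; apply/dualP. Qed.
HB.instance Definition _ :=
  GRing.isLinear.Build R^c (dual N) (dual M) *:%R dual_map dual_map_linear.

End DualMap.

Record proj_resolution (R : pzRingType) (M : lmodType R) := ProjResolution {
  res_mod :> nat -> lmodType R;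
  res_d : forall i, {linear res_mod i.+1 -> res_mod i};
  res_aug : {linear res_mod 0%N -> M};
  res_projective : forall i, projective (res_mod i);
  res_aug_surj : surjective res_aug;
  res_exact0 : exact_at (res_d 0) res_aug;
  res_exactS : forall i, exact_at (res_d i.+1) (res_d i)
}.

(* Ext^i_R(M, N) = 0: every i-cocycle of the complex Hom_R(P, N) is an
   i-coboundary.  This does not depend on the projective resolution P. *)
Definition ext_vanish (R : pzRingType) (i : nat) (M N : lmodType R) : Prop :=
  forall (P : proj_resolution M) (phi : {linear P i -> N}),
    phi \o res_d P i =1 \0 ->
  match i return {linear P i -> N} -> Prop with
  | 0 => fun phi => phi =1 \0
  | j.+1 => fun phi => exists psi : {linear P j -> N}, phi =1 psi \o res_d P j
  end phi.

(* T is (up to isomorphism) the transpose of M computed from some finitely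
   generated projective presentation P1 -> P0 -> M -> 0. *)
Definition is_transpose (R : pzRingType) (M : lmodType R) (T : lmodType R^c) :
    Prop :=
  exists (P1 P0 : lmodType R) (f : {linear P1 -> P0}) (p : {linear P0 -> M})
         (q : {linear dual P1 -> T}),
    [/\ [/\ fin_gen P0, fin_gen P1, projective P0 & projective P1],
        exact_at f p, surjective p,
        exact_at (dual_map f) q & surjective q].

(* Elements of N \cup {infinity}, with None for infinity. *)
Definition natinf := option nat.

Definition lez_inf (i : int) (m : natinf) : bool :=
  if m is Some k then i <= k%:Z else true.

(* The transpose is defined up to projective direct summands, so the choice of
   T is immaterial. *)
Definition torsionfree (R : pzRingType) (m n : natinf) (M : lmodType R) :
    Prop :=
  [/\ fin_gen M,
      forall i : nat, (0 < i)%N -> lez_inf i%:Z m -> ext_vanish i M R^o &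
      exists T : lmodType R^c, is_transpose M T /\
        forall j : nat, (0 < j)%N -> lez_inf j%:Z n -> ext_vanish j T R^c^o].

(* The predecessor i - 1, by cases so that the types G (i - 1) reduce. *)
Definition predz (i : int) : int :=
  match i with
  | Posz 0 => Negz 0
  | Posz k.+1 => Posz k
  | Negz k => Negz k.+1
  end.

Lemma predzE i : predz i = i - 1.
Proof.
case: i => [[|k]|k] //=; first by rewrite -addn1 PoszD addrK.
by rewrite !NegzE -[k.+2]addn1 PoszD opprD.
Qed.

(* Encodes -n <= i <= m + 1. *)
Definition in_range (m n : natinf) (i : int) : bool :=
  lez_inf (i - 1) m && lez_inf (- i) n.

(* Only the terms G i with -n <= i <= m + 1 and the maps between them matter.
   The inner terms are the G (predz i) with both neighbours in range. *)
Definition exact_seq (R : pzRingType) (m n : natinf) (G : int -> lmodType R)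
    (d : forall i, {linear G i -> G (predz i)}) : Prop :=
  forall i, in_range m n i -> in_range m n (predz (predz i)) ->
    exact_at (d i) (d (predz i)).

Definition dual_exact_seq (R : pzRingType) (m n : natinf)
    (G : int -> lmodType R) (d : forall i, {linear G i -> G (predz i)}) :
    Prop :=
  forall i, in_range m n i -> in_range m n (predz (predz i)) ->
    exact_at (dual_map (d (predz i))) (dual_map (d i)).

Definition iso_image (R : pzRingType) (M A B : lmodType R)
    (f : {linear A -> B}) : Prop :=
  exists u : {linear M -> B}, injective u /\ range u = range f.

Definition iso_coker (R : pzRingType) (M A B : lmodType R)
    (f : {linear A -> B}) : Prop :=
  exists p : {linear B -> M}, surjective p /\ exact_at f p.

(* M is isomorphic to the image of the map G 0 -> G (-1), which for n = 0 is
   read as the canonical surjection from G 0 onto Coker (G 1 -> G 0). *)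
Definition iso_image_boundary (R : pzRingType) (n : natinf) (M : lmodType R)
    (G : int -> lmodType R) (d : forall i, {linear G i -> G (predz i)}) :
    Prop :=
  if n == Some 0%N then iso_coker M (d 1) else iso_image M (d 0).

(* Main.v *)
(* Ext^i(M, N) = 0 for i > 0 is obtained by dimension shifting: a complex H over
   M that is exact, and exact under Hom(-, N) at H_i, gives Ext^i(M, N) = 0 as
   soon as Ext^(i-j)(H_j, N) = 0 for all j < i.  Applied to the left half
   G_(m+1) -> ... -> G_0 -> M this yields Ext^i(M, Lambda) = 0 for 1 <= i <= m.
   A projective presentation P1 -> P0 -> M gives an exact sequence
   0 -> M^* -> P0^* -> P1^* -> Tr M -> 0 with projective middle terms; hence
   Ext^1(Tr M) = 0 iff M -> M^** is injective, Ext^2(Tr M) = 0 iff M -> M^** is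
   onto, and Ext^(j+2)(Tr M) = 0 iff Ext^j(M^* ) = 0.  Dimension shifting along
   G_(-n)^* -> ... -> G_(-1)^* -> M^*, whose dual is the original sequence
   because the G_i are reflexive, gives the vanishing of Ext^j(M^* ).
   Conversely the sequence with G_0 = G_(-1) = M and zeros elsewhere works. *)

Require Import Defs.
From HB Require Import structures.
From mathcomp Require Import all_boot all_order all_algebra.
From mathcomp Require Import boolp classical_sets functions.

Set Implicit Arguments.
Unset Strict Implicit.
Unset Printing Implicit Defensive.

Import Order.TTheory GRing.Theory Num.Theory.
Local Open Scope classical_set_scope.
Local Open Scope ring_scope.

(** * Linear maps, kernels and cokernels *)

Section Basics.
Variable R : pzRingType.
Implicit Types A B C : lmodType R.

Lemma surjectiveP (X Y : Type) (f : X -> Y) :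
  surjective f <-> forall y, exists x, f x = y.
Proof.
split=> [sf y | sf].
  have : range f y by rewrite sf.
  by case=> x _ <-; exists x.
by apply/seteqP; split=> // y _; have [x <-] := sf y; exists x.
Qed.

Lemma exact_atP (X Y : Type) (C : nmodType) (f : X -> Y) (g : Y -> C) :
  exact_at f g <->
  (forall x, g (f x) = 0) /\ (forall y, g y = 0 -> exists x, f x = y).
Proof.
rewrite /exact_at; split=> [fg | [gf0 ker_g]].
  split=> [x | y gy0]; first by have: range f (f x) by [exists x]; rewrite fg.
  have: [set y | g y = 0] y by [].
  by rewrite -fg => -[x _ <-]; exists x.
apply/seteqP; split=> y; first by case=> x _ <-; exact: gf0.
by case/ker_g=> x <-; exists x.
Qed.

Definition lin_of A B (f : A -> B) (f_lin : linear f) : {linear A -> B} :=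
  HB.pack f (GRing.isLinear.Build R A B *:%R f f_lin).

(** Choice picks the values, and single-valuedness of [r] turns its closure under linear
    combinations into linearity. The factorisations below only characterise their values, so they
    are obtained this way. *)
Lemma linear_of_rel A B (r : A -> B -> Prop) :
    (forall x, exists y, r x y) -> (forall x y y', r x y -> r x y' -> y = y') ->
    (forall a x x' y y', r x y -> r x' y' -> r (a *: x + x') (a *: y + y')) ->
  exists f : {linear A -> B}, forall x, r x (f x).
Proof.
move=> tot fct lin.
pose f0 x := projT1 (cid (tot x)).
have rf x : r x (f0 x) := projT2 (cid (tot x)).
have f_lin : linear f0.
  by move=> a x y; apply: (fct (a *: x + y)) => //; exact: lin.
by exists (lin_of f_lin).
Qed.

Lemma factor_inj A B C (k : {linear A -> B}) (f : {linear C -> B}) :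
    injective k -> (forall x, exists y, k y = f x) ->
  exists g : {linear C -> A}, forall x, k (g x) = f x.
Proof.
move=> ki kf; apply: (@linear_of_rel C A (fun x y => k y = f x)) => //.
  by move=> x y y' <- /ki.
by move=> a x x' y y' ky ky'; rewrite !linearP ky ky'.
Qed.

Lemma factor_surj A B C (p : {linear A -> B}) (f : {linear A -> C}) :
    surjective p -> (forall x, p x = 0 -> f x = 0) ->
  exists g : {linear B -> C}, forall x, g (p x) = f x.
Proof.
move=> /surjectiveP ps pf.
have [] := @linear_of_rel B C (fun y z => exists2 x, p x = y & f x = z).
- by move=> y; have [x <-] := ps y; exists (f x), x.
- move=> y z z' [x <- <-] [x' pxx' <-]; apply/subr0_eq; rewrite -linearB.
  by apply: pf; rewrite linearB pxx' subrr.
- move=> a y y' z z' [x <- <-] [x' <- <-].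
  by exists (a *: x + x'); rewrite linearP.
move=> g gP; exists g => x.
have [x' pxx' <-] := gP (p x).
by apply/subr0_eq; rewrite -linearB pf // linearB pxx' subrr.
Qed.

Lemma projective_lift (P A B : lmodType R) (g : {linear A -> B})
    (f : {linear P -> B}) :
    projective P -> surjective g ->
  exists h : {linear P -> A}, forall x, g (h x) = f x.
Proof. by move=> Pp gs; have [h hP] := Pp _ _ g f gs; exists h. Qed.

End Basics.

Section Kernel.
Variables (R : pzRingType) (A B : lmodType R) (f : {linear A -> B}).

Definition in_ker : {pred A} := fun x => f x == 0.

Fact in_ker_submod_closed : submod_closed in_ker.
Proof.
split=> [|a x y]; rewrite !unfold_in ?linear0 // => /eqP x0 /eqP y0.
by rewrite linearP x0 y0 scaler0 addr0.
Qed.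
HB.instance Definition _ :=
  GRing.isSubmodClosed.Build R A in_ker in_ker_submod_closed.

Record ker := Ker { ker_val :> A; ker_valP : ker_val \in in_ker }.
HB.instance Definition _ := [isSub for ker_val].
HB.instance Definition _ := [Choice of ker by <:].
HB.instance Definition _ := [SubChoice_isSubLmodule of ker by <:].

End Kernel.
Definition ker_incl (R : pzRingType) (A B : lmodType R) (f : {linear A -> B}) :
  {linear ker f -> A} := \val.

Section Cokernel.
Variables (R : pzRingType) (A B : lmodType R) (f : {linear A -> B}).

Definition in_im : {pred B} := fun y => `[< exists x, f x = y >].

Fact in_im_zmod_closed : zmod_closed in_im.
Proof.
split=> [|x y]; rewrite !unfold_in.
  by apply/asboolP; exists 0; exact: linear0.
move=> /asboolP[a <-] /asboolP[b <-]; apply/asboolP.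
by exists (a - b); exact: linearB.
Qed.
HB.instance Definition _ := GRing.isZmodClosed.Build B in_im in_im_zmod_closed.

Definition coker : Type := Quotient.quot in_im.
HB.instance Definition _ := GRing.Zmodule.on coker.

Definition to_coker (y : B) : coker := (\pi_(Quotient.quot in_im) y)%qT.

Definition coker_repr (u : coker) : B := repr (u : Quotient.quot in_im).

Lemma coker_reprK : cancel coker_repr to_coker.
Proof. by move=> u; exact: reprK. Qed.

Lemma to_coker_eqP (x y : B) :
  to_coker x = to_coker y <-> exists a, f a = x - y.
Proof.
split=> [/eqP|xy]; last apply/eqP;
  rewrite -[_ == _]/(_ == _ %[mod _])%qT -Quotient.idealrBE.
  by move/asboolP.
exact/asboolP.
Qed.

Fact to_cokerB : zmod_morphism to_coker.
Proof. by move=> x y; exact: raddfB. Qed.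
HB.instance Definition _ :=
  GRing.isZmodMorphism.Build B coker to_coker to_cokerB.

Definition coker_scale (a : R) (u : coker) : coker :=
  to_coker (a *: coker_repr u).

(** Two representatives of a class differ by some [f x], and scaling the difference gives
    [f (a *: x)]; hence the action on representatives is well defined. *)
Lemma coker_scaleE a y : coker_scale a (to_coker y) = to_coker (a *: y).
Proof.
have /to_coker_eqP[x fx] := coker_reprK (to_coker y).
by apply/to_coker_eqP; exists (a *: x); rewrite linearZ fx /= scalerBr.
Qed.

Fact coker_scaleA a b u :
  coker_scale a (coker_scale b u) = coker_scale (a * b) u.
Proof. by rewrite -[u]coker_reprK !coker_scaleE scalerA. Qed.
Fact coker_scale1 : left_id 1 coker_scale.
Proof. by move=> u; rewrite -[u]coker_reprK coker_scaleE scale1r. Qed.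
Fact coker_scaleDr : right_distributive coker_scale +%R.
Proof.
move=> a u v; rewrite -[u]coker_reprK -[v]coker_reprK -raddfD !coker_scaleE.
by rewrite scalerDr raddfD.
Qed.
Fact coker_scaleDl u : {morph coker_scale^~ u : a b / a + b}.
Proof.
by move=> a b; rewrite -[u]coker_reprK !coker_scaleE scalerDl raddfD.
Qed.
HB.instance Definition _ :=
  GRing.Zmodule_isLmodule.Build R coker
    coker_scaleA coker_scale1 coker_scaleDr coker_scaleDl.

Fact to_coker_linear : linear to_coker.
Proof.
by move=> a x y; rewrite raddfD; congr (_ + _); exact/esym/coker_scaleE.
Qed.

End Cokernel.

Lemma cokernel_exists (R : pzRingType) (A B : lmodType R)
    (f : {linear A -> B}) :
  exists (C : lmodType R) (q : {linear B -> C}), exact_at f q /\ surjective q.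
Proof.
pose q := lin_of (@to_coker_linear _ _ _ f).
have qE x : q x = 0 <-> exists a, f a = x.
  by rewrite -[0](linear0 q) -[X in exists a, _ = X]subr0; exact: to_coker_eqP.
exists (coker f), q; split.
  by apply/exact_atP; split=> [x|y /qE //]; apply/qE; exists x.
by apply/surjectiveP => u; exists (coker_repr u); exact: coker_reprK.
Qed.

(** * Free covers *)

Section FreeModule.
Variables (R : pzRingType) (X : choiceType).

Definition covers (s : seq X) (c : X -> R^o) : Prop :=
  forall x, x \notin s -> c x = 0.

Definition fin_supp : {pred X -> R^o} := fun c => `[< exists s, covers s c >].

Fact fin_supp_submod_closed : submod_closed fin_supp.
Proof.
split=> [|a c c']; rewrite !unfold_in; first by apply/asboolP; exists [::].
move=> /asboolP[s sc] /asboolP[s' sc']; apply/asboolP; exists (s ++ s') => x.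
rewrite mem_cat negb_or => /andP[/sc cx /sc' cx'].
by rewrite -[LHS]/(a *: c x + c' x) cx cx' scaler0 addr0.
Qed.
HB.instance Definition _ :=
  GRing.isSubmodClosed.Build R (X -> R^o) fin_supp fin_supp_submod_closed.

(** The index type is arbitrary so that the elements of a module can index the basis of its own
    cover, which also covers kernels. *)
Record freemod :=
  Free { free_val :> X -> R^o; free_valP : free_val \in fin_supp }.
HB.instance Definition _ := [isSub for free_val].
HB.instance Definition _ := [Choice of freemod by <:].
HB.instance Definition _ := [SubChoice_isSubLmodule of freemod by <:].


(** The list comes from choice: it contains the support but may be larger. *)
Definition supp_seq (c : freemod) : seq X :=
  undup (projT1 (cid (asboolW (free_valP c)))).

Lemma support_covers c : covers (supp_seq c) c.
Proof.
by rewrite /supp_seq; case: cid => s sc x /=; rewrite mem_undup => /sc.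
Qed.

Lemma free_sum_widen (A : lmodType R) (v : X -> A) (c : freemod) (s t : seq X) :
    uniq s -> uniq t -> covers s c -> {subset s <= t} ->
  \sum_(x <- s) (c x : R) *: v x = \sum_(x <- t) (c x : R) *: v x.
Proof.
move=> us ut sc st; rewrite [RHS](bigID (mem s)) /= [X in _ + X]big1 ?addr0;
  last by move=> x /sc cx; rewrite cx scale0r.
rewrite -[RHS]big_filter; apply: perm_big.
apply: uniq_perm; rewrite ?filter_uniq //.
by move=> x; rewrite mem_filter andb_idr //; exact: st.
Qed.

Definition free_ext_fun (A : lmodType R) (v : X -> A) (c : freemod) : A :=
  \sum_(x <- supp_seq c) (c x : R) *: v x.

(** Both sums widen to the union of the two lists, so the choice made in [supp_seq] does not affect
    the value. Linearity follows by evaluating on one common list. *)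
Lemma free_extE (A : lmodType R) (v : X -> A) (c : freemod) (s : seq X) :
  uniq s -> covers s c -> free_ext_fun v c = \sum_(x <- s) (c x : R) *: v x.
Proof.
move=> us sc; rewrite /free_ext_fun.
rewrite (@free_sum_widen _ v c (supp_seq c) (undup (supp_seq c ++ s))).
- rewrite (@free_sum_widen _ v c s (undup (supp_seq c ++ s))) ?undup_uniq //.
  by move=> x xs; rewrite mem_undup mem_cat xs orbT.
- exact: undup_uniq.
- exact: undup_uniq.
- exact: support_covers.
- by move=> x xs; rewrite mem_undup mem_cat xs.
Qed.

Fact free_ext_linear (A : lmodType R) (v : X -> A) : linear (free_ext_fun v).
Proof.
move=> a c c'; set s := undup (supp_seq c ++ supp_seq c').
have sP (b : freemod) : {subset supp_seq b <= s} -> covers s b.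
  by move=> bs x xs; apply: support_covers; apply: contra xs; exact: bs.
have sc : covers s c by apply: sP => x xs; rewrite mem_undup mem_cat xs.
have sc' : covers s c' by apply: sP => x xs; rewrite mem_undup mem_cat xs orbT.
rewrite !(@free_extE _ v _ s) ?undup_uniq //; last first.
  move=> x xs; rewrite -[LHS]/(a *: c x + c' x).
  by rewrite sc // sc' // scaler0 addr0.
rewrite scaler_sumr -big_split /=; apply: eq_bigr => x _.
by rewrite scalerA -scalerDl.
Qed.

Definition free_ext (A : lmodType R) (v : X -> A) : {linear freemod -> A} :=
  lin_of (free_ext_linear v).

Fact basis_subproof (x : X) :
  (fun y => if y == x then 1 else 0 : R^o) \in fin_supp.
Proof.
rewrite unfold_in; apply/asboolP; exists [:: x] => y.
by rewrite inE => /negPf->.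
Qed.
Definition freemod_basis (x : X) : freemod := Free (basis_subproof x).

Lemma free_ext_basis (A : lmodType R) (v : X -> A) (x : X) :
  free_ext v (freemod_basis x) = v x.
Proof.
rewrite /= (@free_extE _ v _ [:: x]) //; last first.
  by move=> y; rewrite inE => /negPf /= ->.
by rewrite big_seq1 /= eqxx scale1r.
Qed.

Lemma free_basis_sum (c : freemod) :
  c = \sum_(x <- supp_seq c) (c x : R) *: freemod_basis x.
Proof.
apply/val_inj/funext => y.
have valE (s : seq X) :
    val (\sum_(x <- s) (c x : R) *: freemod_basis x) y =
    \sum_(x <- s) (c x : R) * (if y == x then 1 else 0).
  elim: s => [|x s IH]; first by rewrite !big_nil.
  by rewrite !big_cons -IH.
rewrite valE.
have [ys|/[dup] ys /support_covers cy] := boolP (y \in supp_seq c).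
  rewrite (bigD1_seq y) ?undup_uniq //= eqxx mulr1 big1 ?addr0 // => x /negPf.
  by rewrite eq_sym => ->; rewrite mulr0.
rewrite big_seq big1 // => x xs; case: eqP => [yx|_]; last by rewrite mulr0.
by rewrite yx xs in ys.
Qed.

Lemma free_projective : projective freemod.
Proof.
move=> A B g f /surjectiveP gs.
pose v x := projT1 (cid (gs (f (freemod_basis x)))).
have vP x : g (v x) = f (freemod_basis x) :=
  projT2 (cid (gs (f (freemod_basis x)))).
exists (free_ext v) => c /=.
rewrite [in RHS](free_basis_sum c) /free_ext_fun !linear_sum.
by apply: eq_bigr => x _; rewrite !linearZ vP.
Qed.

End FreeModule.

(** * Vanishing of Ext *)

Section ShortExact.
Variable R : pzRingType.

Definition short_exact (K A B : lmodType R) (k : {linear K -> A})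
    (g : {linear A -> B}) : Prop :=
  [/\ injective k, exact_at k g & surjective g].

Lemma ker_short_exact (A B : lmodType R) (g : {linear A -> B}) :
  surjective g -> short_exact (ker_incl g) g.
Proof.
move=> gs; split=> //.
apply/exact_atP; split=> [x|y gy]; first exact/eqP/(ker_valP x).
have y_ker : y \in in_ker g by rewrite unfold_in gy.
by exists (Ker y_ker).
Qed.

Section Pairs.
Variables A B : lmodType R.

Fact inl_linear : linear (fun x : A => (x, 0) : A * B).
Proof. by move=> a x y; rewrite -[RHS]/(_, _) /= scaler0 addr0. Qed.
Fact inr_linear : linear (fun y : B => (0, y) : A * B).
Proof. by move=> a x y; rewrite -[RHS]/(_, _) /= scaler0 addr0. Qed.

Definition in_left : {linear A -> (A * B)%type} := lin_of inl_linear.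
Definition in_right : {linear B -> (A * B)%type} := lin_of inr_linear.

Arguments in_left : simpl never.
Arguments in_right : simpl never.

Lemma linear_pair (C : lmodType R) (f : {linear (A * B)%type -> C}) x y :
  f (x, y) = f (in_left x) + f (in_right y).
Proof.
by rewrite -linearD; congr (f _); congr (_, _); rewrite ?addr0 ?add0r.
Qed.

End Pairs.

Lemma kernel_exists (A B : lmodType R) (g : {linear A -> B}) :
  surjective g ->
  exists (K : lmodType R) (k : {linear K -> A}), short_exact k g.
Proof. by move=> gs; exists (ker g), (ker_incl g); exact: ker_short_exact. Qed.

Lemma projective_prod (P Q : lmodType R) :
  projective P -> projective Q -> projective (P * Q)%type.
Proof.
move=> projP projQ A B g f gs.
have [h1 h1P] := projective_lift (f \o in_left P Q) projP gs.
have [h2 h2P] := projective_lift (f \o in_right P Q) projQ gs.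
exists ((h1 \o fst) \+ (h2 \o snd)) => -[x y] /=.
by rewrite linearD h1P h2P linear_pair.
Qed.

Lemma projective_retract (P Q : lmodType R) (s : {linear Q -> P})
    (r : {linear P -> Q}) : cancel s r -> projective P -> projective Q.
Proof.
move=> srK projP A B g f gs.
have [h hP] := projective_lift (f \o r) projP gs.
by exists (h \o s) => x /=; rewrite hP /= srK.
Qed.

Definition cover (M : lmodType R) : {linear freemod R M -> M} := free_ext id.

Arguments cover : simpl never.

Lemma cover_surj (M : lmodType R) : surjective (cover M).
Proof.
by apply/surjectiveP => x; exists (freemod_basis R x); exact: free_ext_basis.
Qed.

Lemma short_exact_split (K P Q : lmodType R) (k : {linear K -> P})
    (g : {linear P -> Q}) : projective Q -> short_exact k g ->
  exists r : {linear P -> K}, cancel k r.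
Proof.
move=> projQ [ki /exact_atP[gk0 kg] gs].
have [s sP] := projective_lift (idfun : {linear Q -> Q}) projQ gs.
(* As [s] is a section of [g], the map id - s g lands in the kernel of [g] and so factors through
   [k]; the factor is the retraction. *)
have [|r rP] := @factor_inj _ _ _ _ k (idfun \- (s \o g)) ki.
  by move=> x; apply: kg; rewrite /= linearB sP subrr.
by exists r => x; apply: ki; rewrite rP /= gk0 linear0 subr0.
Qed.

(* [ext_zero N i M] means Ext^(i+1)(M, N) = 0: note the shift. *)
Fixpoint ext_zero (N : lmodType R) (i : nat) (M : lmodType R) : Prop :=
  forall (K P : lmodType R) (k : {linear K -> P}) (g : {linear P -> M}),
    projective P -> short_exact k g ->
  if i is j.+1 then ext_zero N j K else
  forall phi : {linear K -> N}, exists psi : {linear P -> N},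
    forall x, psi (k x) = phi x.

(** A short exact sequence ending in a projective splits: maps on the kernel extend along the
    retraction, and the kernel is again projective, which feeds the induction. *)
Lemma projective_ext_zero (N : lmodType R) (i : nat) (M : lmodType R) :
  projective M -> ext_zero N i M.
Proof.
elim: i M => [|i IH] M projM K P k g projP kg;
  have [r rK] := short_exact_split projM kg.
  by move=> phi; exists (phi \o r) => x /=; rewrite rK.
exact/IH/(projective_retract rK).
Qed.

(** * Projective resolutions and the two descriptions of Ext vanishing *)

Section Shift.
Variables (M : lmodType R) (P : proj_resolution M).

Let aug0 x : res_aug P (res_d P 0 x) = 0.
Proof. by have /exact_atP[] := res_exact0 P. Qed.

Fact shift_aug_subproof :
  exists a : {linear P 1%N -> ker (res_aug P)},
    forall x, ker_incl (res_aug P) (a x) = res_d P 0 x.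
Proof.
have [ki /exact_atP[_ kerE] _] := ker_short_exact (res_aug_surj P).
by apply: factor_inj => // x; apply/kerE/aug0.
Qed.

Definition shift_aug := projT1 (cid shift_aug_subproof).
Definition shift_augE x : ker_incl (res_aug P) (shift_aug x) = res_d P 0 x :=
  projT2 (cid shift_aug_subproof) x.

Fact shift_aug_surj : surjective shift_aug.
Proof.
have [ki /exact_atP[gk0 _] _] := ker_short_exact (res_aug_surj P).
apply/surjectiveP => y.
have /exact_atP[_ dP] := res_exact0 P.
have [x xy] := dP _ (gk0 y); exists x; apply: ki.
by rewrite shift_augE.
Qed.

Fact shift_exact0 : exact_at (res_d P 1) shift_aug.
Proof.
have [ki _ _] := ker_short_exact (res_aug_surj P).
have /exact_atP[dd0 dP] := res_exactS P 0.
apply/exact_atP; split=> [x|y y0].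
  by apply: ki; rewrite shift_augE dd0 linear0.
by apply: dP; rewrite -shift_augE y0 linear0.
Qed.

Definition shift_resolution : proj_resolution (ker (res_aug P)) :=
  ProjResolution (res_d := fun i => res_d P i.+1)
    (fun i => @res_projective _ _ P i.+1) shift_aug_surj shift_exact0
    (fun i => res_exactS P i.+1).

End Shift.

Section Cons.
Variables (K P M : lmodType R) (k : {linear K -> P}) (g : {linear P -> M}).
Hypotheses (projP : projective P) (kg : short_exact k g).
Variable Q : proj_resolution K.

Definition cons_mod (i : nat) : lmodType R := if i is j.+1 then Q j else P.

Definition cons_d (i : nat) : {linear cons_mod i.+1 -> cons_mod i} :=
  match i with
  | 0 => (k \o res_aug Q : {linear Q 0%N -> P})
  | j.+1 => res_d Q j
  end.

Fact cons_projective i : projective (cons_mod i).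
Proof. by case: i => [|i] //; exact: res_projective. Qed.

Fact cons_exact0 : exact_at (cons_d 0) g.
Proof.
have [ki /exact_atP[gk0 kerg] gs] := kg.
have /surjectiveP augs := res_aug_surj Q.
apply/exact_atP; split=> [x|y /kerg[z <-]]; first exact: gk0.
by have [x <-] := augs z; exists x.
Qed.

Fact cons_exactS i : exact_at (cons_d i.+1) (cons_d i).
Proof.
case: i => [|i]; last exact: res_exactS.
have [ki _ _] := kg.
have /exact_atP[augd0 aug_ker] := res_exact0 Q.
apply/exact_atP; split=> [x|y /= y0]; first by rewrite /= augd0 linear0.
by apply: aug_ker; apply: ki; rewrite y0 linear0.
Qed.

Fact cons_aug_surj : surjective g. Proof. by case: kg. Qed.

Definition cons_resolution : proj_resolution M :=
  ProjResolution cons_projective cons_aug_surj cons_exact0 cons_exactS.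

End Cons.

Section FreeResolution.
Variable M : lmodType R.

Definition syzygy (i : nat) : lmodType R :=
  iter i (fun N : lmodType R => ker (cover N) : lmodType R) M.

Definition free_res_d (i : nat) :
    {linear freemod R (syzygy i.+1) -> freemod R (syzygy i)} :=
  ker_incl (cover (syzygy i)) \o cover (syzygy i.+1).

(** A general [f] with the kernel of the cover serves both for the augmentation, which is the cover,
    and for the differentials, which are covers followed by inclusions. *)
Fact free_res_exact (B : lmodType R) i
    (f : {linear freemod R (syzygy i) -> B}) :
  (forall x, f x = 0 <-> cover (syzygy i) x = 0) -> exact_at (free_res_d i) f.
Proof.
move=> fE.
have [_ /exact_atP[gk0 kerg] _] := ker_short_exact (cover_surj (syzygy i)).
have /surjectiveP cs := cover_surj (syzygy i.+1).
apply/exact_atP; split=> [x|y /fE/kerg[z <-]]; first by apply/fE/gk0.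
by have [x <-] := cs z; exists x.
Qed.

Fact free_res_exactS i : exact_at (free_res_d i.+1) (free_res_d i).
Proof.
have [ki _ _] := ker_short_exact (cover_surj (syzygy i)).
apply: free_res_exact => x; split=> x0; last first.
  exact: etrans (congr1 (ker_incl (cover (syzygy i))) x0) (linear0 _).
by apply: ki; rewrite [LHS]x0; exact/esym/linear0.
Qed.

Definition free_resolution : proj_resolution M :=
  ProjResolution (fun i => @free_projective R (syzygy i)) (cover_surj M)
    (@free_res_exact M 0 (cover M) (fun x => conj id id)) free_res_exactS.

End FreeResolution.

(** From left to right, a short exact sequence is spliced with a resolution of its kernel, a free
    one in the base case. From right to left, a resolution is cut at its first syzygy, which is
    resolved by the remaining terms. *)
Lemma ext_vanishE (i : nat) (M N : lmodType R) :
  ext_vanish i.+1 M N <-> ext_zero N i M.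
Proof.
elim: i M => [|i IH] M; split=> [extM K P k g projP kg | extM P phi phi0].
- move=> phi; pose Q := free_resolution K.
  have [|psi psiP] := extM (cons_resolution projP kg Q) (phi \o res_aug Q).
    have /exact_atP[augd0 _] := res_exact0 Q.
    by move=> x /=; rewrite [X in phi X]augd0 linear0.
  exists psi => y; have /surjectiveP/(_ y)[x <-] := res_aug_surj Q.
  exact/esym/psiP.
- have [] := @factor_surj _ _ _ _ (shift_aug P) phi (shift_aug_surj P).
    have /exact_atP[_ dP] := shift_exact0 P.
    by move=> x /dP[y <-]; exact: phi0.
  move=> phi' phi'P.
  have [psi psiP] := extM _ _ _ _ (@res_projective _ _ P 0)
    (ker_short_exact (res_aug_surj P)) phi'.
  by exists psi => x; rewrite -phi'P -psiP shift_augE.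
- by apply/IH => Q; exact: (extM (cons_resolution projP kg Q)).
- have /IH extK := extM _ _ _ _ (@res_projective _ _ P 0)
    (ker_short_exact (res_aug_surj P)).
  exact: (extK (shift_resolution P)).
Qed.

(* A projective cover [c] of K and the given [p] combine to a cover [e] of G,
   whose kernel X is an extension of the kernel of p by the kernel of c. *)
Lemma horseshoe (K G M Z P : lmodType R) (k : {linear K -> G})
    (g : {linear G -> M}) (z : {linear Z -> P}) (p : {linear P -> M}) :
    short_exact k g -> short_exact z p -> projective P ->
  exists (W Q X : lmodType R) (w : {linear W -> Q}) (c : {linear Q -> K})
      (x : {linear X -> (Q * P)%type}) (e : {linear (Q * P)%type -> G})
      (s : {linear W -> X}) (t : {linear X -> Z}),
    [/\ projective Q, short_exact w c, short_exact x e & short_exact s t] /\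
    [/\ forall u, x (s u) = (w u, 0), forall u, z (t u) = (x u).2 &
        forall q, e (in_left Q P q) = k (c q)].
Proof.
move=> [ki /exact_atP[gk0 kerg] gs] [zi /exact_atP[pz0 kerp] ps] projP.
have [l lP] := projective_lift p projP gs.
have [Q [c [projQ cs']]] : exists (Q : lmodType R) (c : {linear Q -> K}),
  projective Q /\ surjective c.
  exists (freemod R K), (cover K).
  by split; [exact: free_projective | exact: cover_surj].
have /surjectiveP cs := cs'.
(* The summand Q covers the image of [k], and the lift [l] of [p] through [g] reaches G modulo that
   image. *)
pose e : {linear (Q * P)%type -> G} := (k \o (c \o fst)) \+ (l \o snd).
have es : surjective e.
  apply/surjectiveP => y; have /surjectiveP/(_ (g y))[v pv] := ps.
  have [|y' ky'] := kerg (y - l v); first by rewrite linearB lP pv subrr.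
  by have [q cq] := cs y'; exists (q, v); rewrite /= cq ky' subrK.
have [X [x xe]] := kernel_exists es; have [xi /exact_atP[ex0 kerx] _] := xe.
have [W [w wc]] := kernel_exists cs'; have [wi /exact_atP[cw0 kerw] _] := wc.
have eE (v : Q * P) : e v = k (c v.1) + l v.2 by [].
have [|s sP] := @factor_inj _ _ _ _ x (in_left Q P \o w) xi.
  by move=> u; apply: kerx; rewrite eE [_.1]/= cw0 !linear0 addr0.
have [|t tP] := @factor_inj _ _ _ _ z (snd \o x) zi.
  move=> u; apply: kerp; rewrite -lP /=.
  have := ex0 u; rewrite eE => /(congr1 g).
  by rewrite linearD gk0 add0r linear0.
exists W, Q, X, w, c, x, e, s, t.
split; split=> //.
- split; first by move=> u v /(congr1 x); rewrite !sP => -[] /wi.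
  + apply/exact_atP; split=> [u|u tu0].
      by apply: zi; rewrite tP /= sP linear0.
    have x2 : (x u).2 = 0 by rewrite -[LHS]tP tu0 linear0.
    have := ex0 u.
    rewrite eE x2 linear0 addr0 -[0](linear0 k) => /ki/kerw[v vP].
    exists v; apply: xi; rewrite sP /= vP.
    by case: (x u) x2 => a b /= ->.
  + apply/surjectiveP => v.
    have [|y' ky'] := kerg (l (z v)); first by rewrite lP.
    (* Since [k (c q) = l (z v)], the pair [(- q, z v)] is killed by [e] and gives a preimage of [v]
       under [t]. *)
    have [q cq] := cs y'; have [|u uP] := kerx (- q, z v).
      by rewrite eE /= !linearN cq ky' addNr.
    by exists u; apply: zi; rewrite tP /= uP.
- by move=> q; rewrite eE /= linear0 addr0.
Qed.

(** The stretch Hom(G, N) -> Hom(K, N) -> Ext^1(M, N) -> Ext^1(G, N) of the long exact sequence,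
    with the first map assumed onto. *)
Lemma ext_zero_quotient0 (N K G M : lmodType R) (k : {linear K -> G})
    (g : {linear G -> M}) : short_exact k g ->
    (forall chi : {linear K -> N}, exists chi' : {linear G -> N},
      forall y, chi' (k y) = chi y) ->
  ext_zero N 0 G -> ext_zero N 0 M.
Proof.
move=> kg extK extG Z P z p projP zp phi.
have [W [Q [X [w [c [x [e [s [t []]]]]]]]]] := horseshoe kg zp projP.
move=> [projQ [_ /exact_atP[_ kerc] cs] xe [_ /exact_atP[ts0 _] ts]] [xs zt ek].
have [psi psiP] := extG _ _ _ _ (projective_prod projQ projP) xe (phi \o t).
have [|chi chiP] := @factor_surj _ _ _ _ c (psi \o in_left Q P) cs.
  by move=> q /kerc[u <-]; rewrite /= -xs psiP /= ts0 linear0.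
have [chi' chi'P] := extK chi.
(* On X the map [psi \- (chi' \o e)] agrees with [phi \o t], because e x = 0, and it vanishes on the
   summand Q. Its restriction to P therefore extends [phi]. *)
exists ((psi \o in_right Q P) \- (chi' \o (e \o in_right Q P))) => v.
have /surjectiveP/(_ v)[u <-] := ts.
rewrite -[RHS]psiP /= zt; case: xe => _ /exact_atP[ex0 _] _.
have := ex0 u; case: (x u) => a b /=.
rewrite [e _]linear_pair [psi (a, b)]linear_pair -[psi (in_left _ _ _)]chiP.
by rewrite ek => /eqP; rewrite addr_eq0 -chi'P => /eqP->; rewrite linearN addrC.
Qed.

(** The stretch Ext^(i+1)(K, N) -> Ext^(i+2)(M, N) -> Ext^(i+2)(G, N) of the long exact sequence.
    The horseshoe replaces K, G, M by syzygies W, X, Z in a short exact sequence and lowers each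
    degree by one; for i = 0, maps on W extend to Q and hence to X. *)
Lemma ext_zero_quotientS (N K G M : lmodType R) (k : {linear K -> G})
    (g : {linear G -> M}) (i : nat) : short_exact k g ->
  ext_zero N i K -> ext_zero N i.+1 G -> ext_zero N i.+1 M.
Proof.
elim: i K G M k g => [|i IH] K G M k g kg extK extG Z P z p projP zp;
  have [W [Q [X [w [c [x [e [s [t []]]]]]]]]] := horseshoe kg zp projP;
  move=> [projQ wc xe st] [xs zt ek];
  have extX := extG _ _ _ _ (projective_prod projQ projP) xe;
  have extW := extK _ _ _ _ projQ wc.
- apply: (ext_zero_quotient0 st) => // chi; have [psi psiP] := extW chi.
  by exists (psi \o (fst \o x)) => y /=; rewrite xs psiP.
- exact: IH st extW extX.
Qed.

(** Induction on i, replacing M by the kernel K of [q], onto which H 1 maps by [r]. The vanishing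
    for K and for H 0 gives that for M. Exactness under Hom(-, N) enters only at H (i+1): in the
    base case it extends maps from K to H 0. *)
Lemma ext_zero_of_exact (N : lmodType R) (i : nat) (H : nat -> lmodType R)
    (h : forall j, {linear H j.+1 -> H j}) (M : lmodType R)
    (q : {linear H 0%N -> M}) :
    surjective q -> exact_at (h 0%N) q ->
    (forall j, (j <= i)%N -> exact_at (h j.+1) (h j)) ->
    (forall phi : {linear H i.+1 -> N}, (forall y, phi (h i.+1 y) = 0) ->
      exists psi : {linear H i -> N}, forall y, psi (h i y) = phi y) ->
    (forall j, (j <= i)%N -> ext_zero N (i - j) (H j)) ->
  ext_zero N i M.
Proof.
elim: i H h M q => [|i IH] H h M q qs hq hh Nh extH;
  have [K [k ksq]] := kernel_exists qs;
  have [ki /exact_atP[kq0 kerq] _] := ksq;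
  have /exact_atP[qh0 kerqh] := hq;
  have /exact_atP[hh0 kerhh] := hh 0%N isT;
  have [r rP] := @factor_inj _ _ _ _ k (h 0%N) ki (fun x => kerq _ (qh0 x));
  have rs : surjective r by
    (apply/surjectiveP => y; have [x xP] := kerqh _ (kq0 y);
     exists x; apply: ki; rewrite rP).
- apply: (ext_zero_quotient0 ksq (N := N)); last exact: (extH 0%N).
  move=> chi; have [|psi psiP] := Nh (chi \o r).
    move=> y /=; have -> : r (h 1%N y) = 0 by apply: ki; rewrite rP hh0 linear0.
    by rewrite linear0.
  exists psi => y; have /surjectiveP/(_ y)[x <-] := rs.
  by rewrite rP psiP.
- apply: (ext_zero_quotientS ksq); last exact: (extH 0%N).
  apply: (IH (fun j => H j.+1) (fun j => h j.+1) _ r rs) => //.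
  + apply/exact_atP; split=> [x|y y0].
      by apply: ki; rewrite rP hh0 linear0.
    by apply: kerhh; rewrite -rP y0 linear0.
  + by move=> j ji; exact: hh.
  + by move=> j ji; exact: (extH j.+1).
Qed.

End ShortExact.

(** * Duals and transposes *)

Section Dual.
Variable R : pzRingType.
Implicit Types M P : lmodType R.

Fact dual_eval_linear M (x : M) :
  linear (fun phi : dual M => (phi x : R) : R^c^o).
Proof. by []. Qed.
Definition dual_eval M (x : M) : {linear dual M -> R^c^o} :=
  lin_of (dual_eval_linear x).

(** Injectivity of M -> M^**, stated elementwise. *)
Definition torsionless M : Prop :=
  forall x : M, (forall phi : dual M, phi x = 0) -> x = 0.

(** Surjectivity of M -> M^**; together with [torsionless] this is reflexivity. *)
Definition eval_surj M : Prop :=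
  forall Phi : {linear dual M -> R^c^o}, exists x : M,
    forall phi, Phi phi = dual_eval x phi.

(** The forms [e'] are the coordinates of a section of R^n -> P. *)
Lemma dual_basis P : fin_gen P -> projective P ->
  exists (n : nat) (e : 'I_n -> P) (e' : 'I_n -> dual P),
    forall x, x = \sum_(i < n) (e' i x : R) *: e i.
Proof.
move=> [n [e eP]] projP.
have g_lin : linear (fun c : 'rV[R]_n => \sum_(i < n) c 0 i *: e i).
  move=> a c c'; rewrite scaler_sumr -big_split /=; apply: eq_bigr => i _.
  by rewrite !mxE scalerDl scalerA.
have gs : surjective (lin_of g_lin).
  apply/surjectiveP => x; have [c ->] := eP x; exists (\row_i c i).
  by apply: eq_bigr => i _; rewrite mxE.
have [h hP] := projective_lift (idfun : {linear P -> P}) projP gs.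
have e'_lin i : linear (fun x : P => h x 0 i : R^o).
  by move=> a x y; rewrite linearP !mxE.
by exists n, e, (fun i => lin_of (e'_lin i)) => x; rewrite -[LHS]hP.
Qed.

Lemma torsionless_projective P : fin_gen P -> projective P -> torsionless P.
Proof.
move=> fgP projP x x0; have [n [e [e' eP]]] := dual_basis fgP projP.
by rewrite [x]eP big1 // => i _; rewrite x0 scale0r.
Qed.

(** Dually, the [e'] generate P^* with the evaluations at [e i] as coordinates; this makes P^*
    projective and P -> P^** onto. *)
Lemma dual_expand P (n : nat) (e : 'I_n -> P) (e' : 'I_n -> dual P) :
  (forall x, x = \sum_(i < n) (e' i x : R) *: e i) ->
  forall phi : dual P, phi = \sum_(i < n) (phi (e i) : R^c) *: e' i.
Proof.
move=> eP phi; apply/dualP => x.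
rewrite -[RHS]/(dual_eval x (\sum_(i < n) _)) linear_sum {1}(eP x) linear_sum.
by apply: eq_bigr => i _; rewrite !linearZ.
Qed.

Lemma dual_projective P : fin_gen P -> projective P -> projective (dual P).
Proof.
move=> fgP projP; have [n [e [e' eP]]] := dual_basis fgP projP.
move=> A B g f /surjectiveP gs.
pose a i := projT1 (cid (gs (f (e' i)))).
have aP i : g (a i) = f (e' i) := projT2 (cid (gs (f (e' i)))).
have h_lin : linear (fun phi : dual P => \sum_(i < n) (phi (e i) : R^c) *: a i).
  move=> b phi psi; rewrite scaler_sumr -big_split /=; apply: eq_bigr => i _.
  by rewrite scalerA -scalerDl.
exists (lin_of h_lin) => phi /=.
rewrite [in RHS](dual_expand eP phi) !linear_sum.
by apply: eq_bigr => i _; rewrite !linearZ /= aP.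
Qed.

Lemma eval_surj_projective P : fin_gen P -> projective P -> eval_surj P.
Proof.
move=> fgP projP; have [n [e [e' eP]]] := dual_basis fgP projP.
move=> Phi; exists (\sum_(i < n) (Phi (e' i) : R) *: e i) => phi.
rewrite /= {1}(dual_expand eP phi) !linear_sum.
by apply: eq_bigr => i _; rewrite !linearZ.
Qed.

(** * Ext of the transpose in terms of the bidual *)

Section Transpose.
Variables (M : lmodType R) (T : lmodType R^c).
Hypothesis trT : is_transpose M T.

(* C is the image of [P0^* -> P1^*], which sits in 0 -> C -> P1^* -> T -> 0 and
   0 -> M^* -> P0^* -> C -> 0. *)
Lemma transpose_sequences :
  exists (P1 P0 : lmodType R) (C : lmodType R^c) (f : {linear P1 -> P0})
      (p : {linear P0 -> M}) (q : {linear dual P1 -> T})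
      (c : {linear C -> dual P1}) (f' : {linear dual P0 -> C}),
    [/\ fin_gen P0, fin_gen P1, projective P0 & projective P1] /\
    [/\ exact_at f p, surjective p, short_exact c q,
        short_exact (dual_map p) f' & forall phi, c (f' phi) = dual_map f phi].
Proof.
have [P1 [P0 [f [p [q [[fg0 fg1 proj0 proj1] fp ps fq qs]]]]]] := trT.
have [C [c cq]] := kernel_exists qs.
have [ci /exact_atP[qc0 kerq] _] := cq.
have /exact_atP[qf0 kerqf] := fq.
have [f' f'P] :=
  @factor_inj _ _ _ _ c (dual_map f) ci (fun x => kerq _ (qf0 x)).
exists P1, P0, C, f, p, q, c, f'; split; split=> //.
have /surjectiveP ps' := ps; have /exact_atP[pf0 kerp] := fp.
split.
- move=> phi psi eq_p; apply/dualP => x; have [y <-] := ps' x.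
  exact: (congr1 (fun chi : dual P0 => chi y) eq_p).
- apply/exact_atP; split=> [phi|phi phi0].
    apply: ci; rewrite f'P linear0; apply/dualP => x.
    by rewrite /= pf0 linear0.
  have [|psi psiP] := @factor_surj _ _ _ _ p (phi : {linear P0 -> R^o}) ps.
    move=> y /kerp[x <-].
    have := f'P phi; rewrite phi0 linear0.
    by move=> /(congr1 (fun chi : dual P1 => chi x))/esym.
  by exists (psi : dual M); apply/dualP.
- apply/surjectiveP => y; have [phi phiP] := kerqf _ (qc0 y).
  by exists phi; apply: ci; rewrite f'P.
Qed.

(** A form on C pulls back to P0^* as evaluation at some y such that all forms on M kill p y. It
    extends to P1^* exactly when y = f z for some z, that is, when p y = 0. *)
Lemma transpose_ext1 : ext_zero R^c^o 0 T <-> torsionless M.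
Proof.
have [P1 [P0 [C [f [p [q [c [f' []]]]]]]]] := transpose_sequences.
move=> [fg0 fg1 proj0 proj1] [/exact_atP[pf0 kerp] /surjectiveP ps cq pf' f'P].
have [_ /exact_atP[f'p0 kerf'] f's] := pf'.
split=> [extT x x0 | tlM].
- have [y xy] := ps x.
  have [|Phi PhiP] := @factor_surj _ _ _ _ f' (dual_eval y) f's.
    by move=> phi /kerf'[psi <-]; rewrite /= xy x0.
  have [Psi PsiP] := extT _ _ _ _ (dual_projective fg1 proj1) cq Phi.
  have [z zP] := eval_surj_projective fg1 proj1 Psi.
  suff yz : y = f z by rewrite -xy yz pf0.
  apply/subr0_eq/(torsionless_projective fg0 proj0) => phi.
  have := PhiP phi; rewrite -PsiP zP f'P /= => yz.
  by rewrite linearB yz subrr.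
- apply: (ext_zero_quotient0 cq).
    move=> Phi; have [y yP] := eval_surj_projective fg0 proj0 (Phi \o f').
    have [z fz] : exists z, f z = y.
      apply/kerp/tlM => phi; have := yP (dual_map p phi).
      by rewrite /= f'p0 linear0.
    exists (dual_eval z) => u; have /surjectiveP/(_ u)[phi <-] := f's.
    by rewrite f'P -[RHS]/((Phi \o f') phi) yP -fz.
  exact/projective_ext_zero/dual_projective.
Qed.

(** After one shift the condition is Ext^1(C) = 0: every form on M^* extends to P0^*. There it is
    evaluation at some y, so on M^* it is evaluation at p y. *)
Lemma transpose_ext2 : ext_zero R^c^o 1 T <-> eval_surj M.
Proof.
have [P1 [P0 [C [f [p [q [c [f' []]]]]]]]] := transpose_sequences.
move=> [fg0 fg1 proj0 proj1] [_ /surjectiveP ps cq pf' _].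
split=> [extT Phi | esM].
- have [Psi PsiP] := extT _ _ _ _ (dual_projective fg1 proj1) cq _ _ _ _
    (dual_projective fg0 proj0) pf' Phi.
  have [y yP] := eval_surj_projective fg0 proj0 Psi.
  by exists (p y) => phi; rewrite -PsiP yP.
- apply: (ext_zero_quotientS cq);
    last exact/projective_ext_zero/dual_projective.
  apply: (ext_zero_quotient0 pf');
    last exact/projective_ext_zero/dual_projective.
  move=> Phi; have [x xP] := esM Phi; have [y yx] := ps x.
  by exists (dual_eval y) => phi; rewrite xP -yx.
Qed.

Lemma transpose_extSS i :
  ext_zero R^c^o i.+2 T <-> ext_zero R^c^o i (dual M).
Proof.
have [P1 [P0 [C [f [p [q [c [f' []]]]]]]]] := transpose_sequences.
move=> [fg0 fg1 proj0 proj1] [_ _ cq pf' _].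
split=> [extT | extM].
  exact: (extT _ _ _ _ (dual_projective fg1 proj1) cq _ _ _ _
    (dual_projective fg0 proj0) pf').
apply: (ext_zero_quotientS cq); last exact/projective_ext_zero/dual_projective.
apply: (ext_zero_quotientS pf') => //.
exact/projective_ext_zero/dual_projective.
Qed.

End Transpose.

Lemma fin_gen_prod (A B : lmodType R) :
  fin_gen A -> fin_gen B -> fin_gen (A * B)%type.
Proof.
move=> [n [e eP]] [m [e' e'P]].
exists (n + m)%N, (fun i => match fintype.split i with
  | inl j => in_left A B (e j) | inr j => in_right A B (e' j) end) => -[x y].
have [c ->] := eP x; have [c' ->] := e'P y.
exists (fun i => match fintype.split i with inl j => c j | inr j => c' j end).
rewrite big_split_ord /=.
rewrite [LHS](linear_pair (idfun : {linear (A * B)%type -> (A * B)%type})).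
rewrite -[LHS]/(in_left A B _ + in_right A B _) !linear_sum.
congr (_ + _); apply: eq_bigr => i _; rewrite linearZ.
  by rewrite (unsplitK (inl i)).
by rewrite (unsplitK (inr i)).
Qed.

(** Supplies the presentation of M demanded by [torsionfree]. M is generated by P0, and its
    relations are those of G0 together with the image of G1; Q covers G1 and [l] lifts its map to
    P0. *)
Lemma transpose_exists (G1 G0 M : lmodType R) (T1 T0 : lmodType R^c)
    (g : {linear G1 -> G0}) (q : {linear G0 -> M}) :
    is_transpose G1 T1 -> is_transpose G0 T0 -> exact_at g q -> surjective q ->
  exists T : lmodType R^c, is_transpose M T.
Proof.
move=> [_ [Q [_ [r [_ [[fgQ _ projQ _] _ rs _ _]]]]]].
move=> [P1 [P0 [f [p [_ [[fg0 fg1 proj0 proj1] fp ps _ _]]]]]] gq qs.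
have [l lP] := projective_lift (g \o r) projQ ps.
pose F : {linear (P1 * Q)%type -> P0} := (f \o fst) \+ (l \o snd).
have [T [t [Ft ts]]] := cokernel_exists (dual_map F).
exists T, (P1 * Q)%type, P0, F, (q \o p), t; split=> //.
- by split=> //; [exact: fin_gen_prod | exact: projective_prod].
- move/surjectiveP: rs => rs.
  have /exact_atP[pf0 kerp] := fp; have /exact_atP[qg0 kerq] := gq.
  apply/exact_atP; split=> [[a b]|y /= /kerq[x gx]].
    by rewrite /= linearD pf0 add0r lP /= qg0.
  have [b rb] := rs x; have [|a fa] := kerp (y - l b).
    by rewrite linearB lP /= rb gx subrr.
  by exists (a, b); rewrite /= fa subrK.
- move/surjectiveP: ps => ps; move/surjectiveP: qs => qs.
  apply/surjectiveP => z; have [y <-] := qs z; have [x <-] := ps y.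
  by exists x.
Qed.

(** Only the existence of a transpose remains. Its Ext conditions in degrees 1, 2 and i+3 become
    injectivity of M -> M^**, surjectivity, and Ext^(i+1) of the dual; [ext_zero] at i is degree
    i+1. *)
Lemma torsionfreeP (m n : natinf) (M : lmodType R) :
  torsionfree m n M <->
  [/\ [/\ fin_gen M, exists T : lmodType R^c, is_transpose M T &
          forall i, lez_inf i.+1%:Z m -> ext_zero R^o i M],
      lez_inf 1 n -> torsionless M, lez_inf 2 n -> eval_surj M &
      forall i, lez_inf i.+3%:Z n -> ext_zero R^c^o i (dual M)].
Proof.
split=> [[fgM extM [T [trT extT]]] | [[fgM [T trT] extM] tlM esM extM']].
  have extT' i : lez_inf i.+1%:Z n -> ext_zero R^c^o i T.
    by move=> ?; apply/ext_vanishE/extT.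
  split.
  - by split=> // [|i ?]; [exists T | apply/ext_vanishE/extM].
  - by move=> n1; exact/(transpose_ext1 trT)/extT'.
  - by move=> n2; exact/(transpose_ext2 trT)/extT'.
  - by move=> i ni; apply/(transpose_extSS trT)/extT'.
split=> //; first by case=> // i _ mi; exact/ext_vanishE/extM.
exists T; split=> // -[//|i _ ni]; apply/ext_vanishE.
case: i ni => [|[|i]] ni.
- exact/(transpose_ext1 trT)/tlM.
- exact/(transpose_ext2 trT)/esM.
- exact/(transpose_extSS trT)/extM'.
Qed.

Lemma torsionfree_trivial (m n : natinf) (Z : lmodType R) :
  (forall x : Z, x = 0) -> torsionfree m n Z.
Proof.
move=> Z0; have dZ0 (phi : dual Z) : phi = 0.
  by apply/dualP => x; rewrite [x]Z0 linear0.
have fgZ : fin_gen Z.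
  by exists 0%N, (fun _ => 0) => x; exists (fun _ => 0); rewrite big_ord0.
(* The ring varies because this is applied both to Z and to its dual, which lives over [R^c]. *)
have projZ (S : pzRingType) (Y : lmodType S) :
    (forall y : Y, y = 0) -> projective Y.
  by move=> Y0 A B g f _; exists (\0) => y; rewrite [y]Y0 !linear0.
apply/torsionfreeP; split.
- split=> //; last by move=> i _; exact/projective_ext_zero/projZ.
  exists (dual Z), Z, Z, (\0 : {linear Z -> Z}), (idfun : {linear Z -> Z}).
  exists (idfun : {linear dual Z -> dual Z}).
  split; [split=> //; exact: projZ | | | |].
  + apply/exact_atP; split=> [x|y _]; first by rewrite [LHS]Z0.
    by exists 0; rewrite [y]Z0.
  + by apply/surjectiveP => y; exists y.
  + apply/exact_atP; split=> [x|y _]; first by rewrite [LHS]dZ0.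
    by exists 0; rewrite [y]dZ0 linear0.
  + by apply/surjectiveP => y; exists y.
- by move=> _ x _; exact: Z0.
- by move=> _ Phi; exists 0 => phi; rewrite [phi]dZ0 !linear0.
- by move=> i _; exact/projective_ext_zero/projZ.
Qed.

End Dual.

(** * The boundary of an exact sequence *)

Section Boundary.
Variables (R : pzRingType) (m n : natinf) (M : lmodType R).

Lemma lez_inf_le (l : natinf) (i j : nat) :
  (i <= j)%N -> lez_inf j%:Z l -> lez_inf i%:Z l.
Proof. by case: l => //= k; rewrite !lez_nat; exact: leq_trans. Qed.

Lemma in_range0 : in_range m n 0.
Proof. by rewrite /in_range; case: m n => [?|] [?|]. Qed.

Lemma in_rangeS (k : nat) : lez_inf k%:Z m -> in_range m n k.+1%:Z.
Proof.
rewrite /in_range -predzE /= => ->.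
by case: n.
Qed.

Lemma in_rangeN (k : nat) : lez_inf k.+1%:Z n -> in_range m n (Negz k).
Proof.
rewrite /in_range -predzE NegzE opprK => ->; rewrite andbT.
by case: m.
Qed.

(** * The sequence 0 -> M = M -> 0 *)

Section Degenerate.
Variables (Z : lmodType R).
Hypothesis Z0 : forall x : Z, x = 0.

Definition one_term (i : int) : lmodType R :=
  match i with Posz 0 => M | Negz 0 => M | _ => Z end.

Definition one_term_d (i : int) : {linear one_term i -> one_term (predz i)} :=
  match i with
  | Posz 0 => (idfun : {linear M -> M})
  | Posz 1 => (\0 : {linear Z -> M})
  | Posz k.+2 => (\0 : {linear Z -> one_term (Posz k.+1)})
  | Negz 0 => (\0 : {linear M -> Z})
  | Negz k.+1 => (\0 : {linear Z -> Z})
  end.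

Lemma exact_trivial (S : pzRingType) (A B C : lmodType S) (f : {linear A -> B})
    (g : {linear B -> C}) : (forall y : B, y = 0) -> exact_at f g.
Proof.
move=> B0; apply/exact_atP; split=> [x|y _]; first by rewrite [f x]B0 linear0.
by exists 0; rewrite [y]B0 linear0.
Qed.

Lemma one_term_exact : exact_seq m n one_term_d.
Proof.
move=> [[|[|k]]|k] _ _; try exact: exact_trivial.
- by apply/exact_atP; split=> [x|y _]; last exists y.
- by apply/exact_atP; split=> [x|y /= ->]; last exists 0.
Qed.

Lemma one_term_dual_exact : dual_exact_seq m n one_term_d.
Proof.
have dZ0 (phi : dual Z) : phi = 0 by apply/dualP => x; rewrite [x]Z0 linear0.
move=> [[|[|k]]|k] _ _; try exact: exact_trivial.
- apply/exact_atP; split=> [phi|phi phi0].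
    by apply/dualP => x; exact: (linear0 phi).
  by exists 0; rewrite linear0 -phi0; apply/dualP.
- apply/exact_atP; split=> [phi|phi _]; last by exists phi; apply/dualP.
  by apply/dualP => x /=; rewrite linear0.
Qed.

(** The identity of M is the witness in both readings: as cokernel of 0 -> M if n = 0, as image of
    [d 0] otherwise. *)
Lemma one_term_image : iso_image_boundary n M one_term_d.
Proof.
rewrite /iso_image_boundary; case: eqP => _;
  exists (idfun : {linear M -> M}) => //.
split; first by apply/surjectiveP => y; exists y.
by apply/exact_atP; split=> [x|y /= ->]; last exists 0.
Qed.

End Degenerate.

(** * From an exact sequence with exact dual to torsionfreeness *)

Section Backward.
Variables (G : int -> lmodType R)
  (d : forall i : int, {linear G i -> G (predz i)}).
Hypotheses (Gtf : forall i, in_range m n i -> torsionfree m n (G i))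
  (exG : exact_seq m n d) (exGd : dual_exact_seq m n d).

(** Dimension shifting for Ext^(i+1) needs dual exactness at G_(i+1), hence the term G_(i+2). With i
    + 1 = m this is the leftmost term G_(m+1). *)
Lemma boundary_ext (q : {linear G 0 -> M}) (i : nat) :
    surjective q -> exact_at (d 1) q -> lez_inf i.+1%:Z m -> ext_zero R^o i M.
Proof.
move=> qs dq mi.
have range_le j : (j <= i.+2)%N -> in_range m n j%:Z.
  case: j => [|j] ji; first exact: in_range0.
  by apply: in_rangeS; apply: lez_inf_le mi.
apply: (@ext_zero_of_exact _ _ i (fun j => G j%:Z)
  (fun j => d j.+1%:Z) M q) => //.
- move=> j ji; apply: (exG (i := j.+2%:Z)); apply: range_le => //.
  by rewrite ltnW // ltnW.
- have /exact_atP[_ kerd] := exGd (i := i.+2%:Z)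
    (range_le _ (leqnn _)) (range_le _ (leqW (leqnSn _))).
  move=> phi phi0; have [|psi psiP] := kerd phi; first exact/dualP.
  by exists psi => y; rewrite -psiP.
- move=> j ji.
  have /Gtf/torsionfreeP[[_ _ extG] _ _ _] := range_le j (leqW (leqW ji)).
  by apply: extG; apply: lez_inf_le mi; rewrite ltnS leq_subr.
Qed.

Lemma boundary_transpose (q : {linear G 0 -> M}) :
    surjective q -> exact_at (d 1) q ->
  exists T : lmodType R^c, is_transpose M T.
Proof.
have /Gtf/torsionfreeP[[_ [T0 trT0] _] _ _ _] := in_range0.
have /Gtf/torsionfreeP[[_ [T1 trT1] _] _ _ _] : in_range m n 1.
  by apply: (@in_rangeS 0); case: (m).
by move=> qs dq; apply: transpose_exists trT1 trT0 dq qs.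
Qed.

(** * The case n > 0, with [d 0] factored through its image M *)

Section Image.
Variables (u : {linear M -> G (Negz 0)}) (q : {linear G 0 -> M}).
Hypotheses (u_inj : injective u) (q_surj : surjective q)
  (uq : forall x, u (q x) = d 0 x) (n1 : lez_inf 1 n).

Lemma image_torsionless : torsionless M.
Proof.
have /Gtf/torsionfreeP[_ tlG _ _] := in_rangeN n1.
move=> x x0; apply: u_inj; rewrite linear0; apply: tlG => // phi.
exact: (x0 (dual_map u phi)).
Qed.

(** For a form chi on M, chi q vanishes on the image of [d 1]; dual exactness at G_0 writes it as
    psi (d 0) = psi u q, and q cancels. *)
Lemma dual_boundary_surj : surjective (dual_map u).
Proof.
have r1 : in_range m n 1 by apply: (@in_rangeS 0); case: (m).
have /exact_atP[dd0 _] := exG (i := 1) r1 (in_rangeN n1).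
have /exact_atP[_ kerd] := exGd (i := 1) r1 (in_rangeN n1).
apply/surjectiveP => chi; have [|psi psiP] := kerd (dual_map q chi).
  apply/dualP => x; rewrite /= -[RHS](linear0 chi); congr (chi _).
  by apply: u_inj; rewrite uq dd0 linear0.
exists psi; apply/dualP => x; have /surjectiveP/(_ x)[y <-] := q_surj.
by rewrite /= uq; exact: (congr1 (fun phi : dual (G 0) => phi y) psiP).
Qed.

(** Pushed to G_(-1), Phi is evaluation at some y. All forms on G_(-2) kill the image of y, so this
    image is 0, and exactness at G_(-1) puts y in the image of M. *)
Lemma image_eval_surj : lez_inf 2 n -> eval_surj M.
Proof.
move=> n2 Phi.
have /Gtf/torsionfreeP[_ _ /(_ n2) esG _] := in_rangeN n1.
have /Gtf/torsionfreeP[_ /(_ n1) tlG _ _] := in_rangeN n2.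
have [y yP] := esG (Phi \o dual_map u).
have /exact_atP[dd0 kerd] := exG (i := 0) in_range0 (in_rangeN n2).
have [|z zP] := kerd y.
  apply: tlG => // phi; have := yP (dual_map (d (Negz 0)) phi).
  rewrite /= => <-; rewrite -[RHS](linear0 Phi); congr (Phi _).
  apply/dualP => x; have /surjectiveP/(_ x)[w <-] := q_surj.
  by rewrite /= uq [X in phi X]dd0 linear0.
exists (q z) => chi; have /surjectiveP/(_ chi)[psi <-] := dual_boundary_surj.
by have := yP psi; rewrite /= uq zP.
Qed.

(** Dimension shifting along the duals of G_(-1), ..., G_(-i-3). A form on the dual of G_(-i-2) is
    evaluation at some y; if it kills the forms coming from G_(-i-3), then y maps to 0 there and
    exactness lifts y to G_(-i-1). *)
Lemma image_dual_ext (i : nat) : lez_inf i.+3%:Z n -> ext_zero R^c^o i (dual M).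
Proof.
move=> ni.
have range_le j : (j <= i.+2)%N -> in_range m n (Negz j).
  by move=> ji; apply: in_rangeN; apply: lez_inf_le ni.
apply: (@ext_zero_of_exact _ _ i (fun j => dual (G (Negz j)))
  (fun j => dual_map (d (Negz j))) _ (dual_map u)).
- exact: dual_boundary_surj.
- have /exact_atP[dd0 kerd] := exGd (i := 0) in_range0 (range_le 1%N isT).
  apply/exact_atP; split=> [phi|phi phi0].
    apply/dualP => x; have /surjectiveP/(_ x)[y <-] := q_surj.
    by rewrite /= uq; exact: (congr1 (fun psi : dual (G 0) => psi y) (dd0 phi)).
  apply: kerd; apply/dualP => y; rewrite /= -uq.
  exact: (congr1 (fun psi : dual M => psi (q y)) phi0).
- move=> j ji; apply: (exGd (i := Negz j)); apply: range_le => //.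
  by rewrite ltnW // ltnW.
- move=> Phi Phi0.
  have /Gtf/torsionfreeP[_ _ esG _] := range_le i.+1 (leqnSn _).
  have /Gtf/torsionfreeP[_ tlG _ _] := range_le i.+2 (leqnn _).
  have [y yP] := esG (lez_inf_le (isT : 2 <= i.+3)%N ni) Phi.
  have /exact_atP[_ kerd] :=
    exG (i := Negz i) (range_le i (leqW (leqnSn _))) (range_le i.+2 (leqnn _)).
  have [|z zP] := kerd y.
    apply: (tlG n1) => phi.
    by have := yP (dual_map (d (Negz i.+1)) phi); rewrite Phi0.
  by exists (dual_eval z) => phi; rewrite yP -zP.
- move=> j ji.
  have /Gtf/torsionfreeP[_ _ _ extG] := range_le j (leqW (leqW ji)).
  by apply: extG; apply: lez_inf_le ni; rewrite !ltnS leq_subr.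
Qed.

End Image.

(** For n = 0 the conditions on the transpose are void and [q] is the given cokernel map. Otherwise
    [q] is [d 0] corestricted to M, and exactness at G_0 makes M the cokernel of [d 1]. *)
Lemma torsionfree_boundary :
  fin_gen M -> iso_image_boundary n M d -> torsionfree m n M.
Proof.
move=> fgM; rewrite /iso_image_boundary; case: eqP;
  [move=> n0 [q [qs dq]] | move=> n0 [u [ui u_range]]].
  apply/torsionfreeP; rewrite n0; split=> //; split=> //.
    exact: boundary_transpose dq.
  by move=> i; exact: boundary_ext dq.
have n1 : lez_inf 1 n by case: (n) n0 => [[|k]|].
have im_u x : exists y, u y = d 0 x.
  have : range (d 0) (d 0 x) by exists x.
  by rewrite -u_range => -[y _ <-]; exists y.
have [q uq] := factor_inj ui im_u.
have qs : surjective q.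
  apply/surjectiveP => y; have : range u (u y) by exists y.
  by rewrite u_range => -[x _ dx]; exists x; apply: ui; rewrite uq.
have r1 : in_range m n 1 by apply: (@in_rangeS 0); case: (m).
have /exact_atP[dd0 kerd] := exG (i := 1) r1 (in_rangeN n1).
have dq : exact_at (d 1) q.
  apply/exact_atP; split=> [x|y y0]; first by apply: ui; rewrite uq dd0 linear0.
  by apply: kerd; rewrite -[LHS]uq y0 linear0.
apply/torsionfreeP; split.
- split=> //; first exact: boundary_transpose dq.
  by move=> i; exact: boundary_ext dq.
- by move=> _; exact: (image_torsionless ui n1).
- exact: image_eval_surj uq n1.
- by move=> i; exact: image_dual_ext uq n1 i.
Qed.

End Backward.
End Boundary.

Theorem theorem1p1 (Lambda : pzRingType)
    (noeth_l : left_noetherian Lambda) (noeth_r : left_noetherian Lambda^c)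
    (m n : natinf) (M : lmodType Lambda^c) (fgM : fin_gen M) :
  torsionfree m n M <->
  exists (G : int -> lmodType Lambda^c)
         (d : forall i : int, {linear G i -> G (predz i)}),
    [/\ forall i : int, in_range m n i -> torsionfree m n (G i),
        exact_seq m n d,
        dual_exact_seq m n d &
        iso_image_boundary n M d].
Proof.
split=> [tfM | [G [d [tfG exG exGd Md]]]];
  last exact: torsionfree_boundary exGd fgM Md.
pose Z : lmodType Lambda^c := 'rV[Lambda^c]_0.
have Z0 (x : Z) : x = 0 by exact: thinmx0.
exists (one_term M Z), (one_term_d M Z); split.
- by case=> [[|k]|[|k]] _ //=; exact: torsionfree_trivial.
- exact: one_term_exact.
- exact: one_term_dual_exact.
- exact: one_term_image.
Qed.
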